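(* In the framework described in the context, suppose that $$q_{\ast}=\|(\mathcal{T}-\mathcal{T}_h)\mathcal{G}\|_{L(\widehat{\Gamma},\mathcal{X})}\,\|\widehat{\mathcal{A}}^{-1}\|_{L(\widehat{\Delta},\widehat{\Gamma})}<1 .$$ Then there exists a nonempty set $\widehat{\Gamma}_{\ast}\subseteq\widehat{\Gamma}_h$, closed in $\widehat{\Gamma}_h$, such that the restriction $\widehat{\mathcal{A}}_{\ast}=\widehat{\mathcal{A}}_h|_{\widehat{\Gamma}_{\ast}}$ is an isomorphism of $\widehat{\Gamma}_{\ast}$ onto $\widehat{\Delta}_h$. One has $\widehat{\Gamma}_{\ast}=\widehat{\mathcal{K}}^{-1}(\mathcal{Z}\times\mathcal{T}_h(\mathcal{Y}))=\widehat{\mathcal{K}}^{-1}(\mathcal{Z}\times\mathcal{X}_h)=\widehat{\mathcal{K}}^{-1}(\widehat{\Delta}_h)$ and $$\|\widehat{\mathcal{A}}_{\ast}^{-1}\|_{L(\widehat{\Delta}_h,\widehat{\Gamma}_h)}\le(1-q_{\ast})^{-1}\|\widehat{\mathcal{A}}^{-1}\|_{L(\widehat{\Delta},\widehat{\Gamma})}.$$ Moreover, let $\widehat{\mathcal{F}}=[\mathcal{F}_{\mathcal{B}},\mathcal{F}]^T\in\widehat{\Sigma}$. Then there exists a unique solution $(x_h,U_h)\in\widehat{\Gamma}_h$ of the approximate problem $$\mathcal{B}(x_h,U_h)=\mathcal{F}_{\mathcal{B}},\qquad U_h-\mathcal{T}_h\mathcal{G}(x_h,U_h)=\mathcal{T}_h\mathcal{F},$$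 which approximates the unique solution $(x,U)\in\widehat{\Gamma}$ of the exact problem $$\mathcal{B}(x,U)=\mathcal{F}_{\mathcal{B}},\qquad U-\mathcal{T}\mathcal{G}(x,U)=\mathcal{T}\mathcal{F},$$ and $$\|(x,U)-(x_h,U_h)\|_{\widehat{\Gamma}}\le(1-q_{\ast})^{-1}\|\widehat{\mathcal{A}}^{-1}\|_{L(\widehat{\Delta},\widehat{\Gamma})}\,\|(\mathcal{T}-\mathcal{T}_h)\mathcal{T}^{-1}U\|_{\mathcal{X}} .$$
   Context: An isomorphism between normed spaces is a linear continuous bijection with continuous inverse. Finite products of Banach spaces carry the sum of the component norms. $L(E,F)$ is the space of continuous linear operators from $E$ to $F$. Framework. $\mathcal{Q},\mathcal{X},\mathcal{Y},\mathcal{Z}$ are Banach spaces, $\widehat{\Gamma}=\mathcal{Q}\times\mathcal{X}$, $\widehat{\Sigma}=\mathcal{Z}\times\mathcal{Y}$, $\widehat{\Delta}=\mathcal{Z}\times\mathcal{X}$. $\mathcal{T}$ is an isomorphism of $\mathcal{Y}$ onto $\mathcal{X}$. $\mathcal{G}\in L(\mathcal{Q}\times\mathcal{X},\mathcal{Y})$ and $\mathcal{B}\in L(\mathcal{Q}\times\mathcal{X},\mathcal{Z})$. The operator $\widehat{\mathcal{A}}\in L(\widehat{\Gamma},\widehat{\Delta})$ is $$\widehat{\mathcal{A}}(x,U)=[\mathcal{B}(x,U),\;U-\mathcal{T}\mathcal{G}(x,U)]^T ,$$ and $\widehat{\mathcal{A}}=\widehat{\mathcal{T}}\widehat{\Phi}$,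 where $\widehat{\mathcal{T}}(\zeta,\eta)=[\zeta,\mathcal{T}\eta]^T$ and $\widehat{\Phi}$ is an isomorphism of $\widehat{\Gamma}$ onto $\widehat{\Sigma}$; hence $\widehat{\mathcal{A}}$ is an isomorphism of $\widehat{\Gamma}$ onto $\widehat{\Delta}$. $\mathcal{X}_h$ is a closed subspace of $\mathcal{X}$, $\mathcal{T}_h\in L(\mathcal{Y},\mathcal{X}_h)$ with $\mathcal{X}_h=\mathcal{T}_h(\mathcal{Y})$, $\widehat{\Gamma}_h=\mathcal{Q}\times\mathcal{X}_h$, $\widehat{\Delta}_h=\mathcal{Z}\times\mathcal{X}_h$. The operator $\widehat{\mathcal{K}}\in L(\widehat{\Gamma},\widehat{\Delta})$ is $\widehat{\mathcal{K}}(x,U)=[\mathcal{B}(x,U),\,U-\mathcal{T}_h\mathcal{G}(x,U)]^T$, and $\widehat{\mathcal{A}}_h\in L(\widehat{\Gamma}_h,\widehat{\Delta}_h)$ is $\widehat{\mathcal{A}}_h(x_h,U_h)=[\mathcal{B}(x_h,U_h),\,U_h-\mathcal{T}_h\mathcal{G}(x_h,U_h)]^T$. *)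

(* Defs.v *)
From HB Require Import structures.
From mathcomp Require Import all_boot all_order all_algebra.
From mathcomp Require Import all_classical all_reals all_analysis.
From mathcomp.real_closed Require Import complex.

Set Implicit Arguments.
Unset Strict Implicit.
Unset Printing Implicit Defensive.

Import Order.TTheory GRing.Theory Num.Theory.
Import numFieldNormedType.Exports.

Local Open Scope classical_set_scope.
Local Open Scope ring_scope.

(* Norms take their values in the scalar field [K].  The least upper bound
   property of the reals of [K] covers real and complex scalars at once, see
   [real_complete_realType] and [real_complete_complex]. *)
Definition real_complete (K : numDomainType) : Prop :=
  forall A : set K, A !=set0 -> A `<=` [set` Num.real] -> has_ubound A ->
    exists l, supremums A l.

Lemma real_complete_realType (R : realType) : real_complete R.
Proof.
move=> A A0 _ [M uM]; exists (sup A); split.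
  by apply: sup_upper_bound; split=> //; exists M.
by move=> u; exact: ge_sup.
Qed.

Lemma real_complete_complex (R : realType) : real_complete (complex R).
Proof.
move=> A A0 Areal [M ubM]; have [a Aa] := A0.
have ImA z : A z -> complex.Im z = 0.
  move=> /Areal; case: z => x y; rewrite /= realE !lecE /=.
  by rewrite (eq_sym 0) => /orP[] /andP[/eqP].
pose B := [set complex.Re z | z in A].
have B0 : B !=set0 by exists (complex.Re a), a.
have hB : has_sup B.
  split=> //; exists (complex.Re M) => _ [z Az <-].
  by have := ubM z Az; rewrite lecE => /andP[].
exists (Complex (sup B) 0); split.
  move=> z Az; rewrite lecE /= (ImA z Az) eqxx /=.
  by apply: sup_upper_bound => //; exists z.
move=> u ubu; rewrite lecE /=; apply/andP; split.
  by have := ubu a Aa; rewrite lecE (ImA a Aa) => /andP[].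
apply: ge_sup => // _ [z Az <-].
by have := ubu z Az; rewrite lecE => /andP[].
Qed.

(* [E * F] normed by the sum of the norms; the library norms [E * F] by the
   maximum. *)
Definition sumprod (E F : Type) : Type := (E * F)%type.

Section Sumprod.
Context {K : numFieldType} {E F : normedModType K}.

HB.instance Definition _ := GRing.Lmodule.copy (sumprod E F) (E * F)%type.

Definition sumprod_norm (p : sumprod E F) : K := `|p.1| + `|p.2|.

Let sumprod_ler_normD (p q : sumprod E F) :
  sumprod_norm (p + q) <= sumprod_norm p + sumprod_norm q.
Proof. by rewrite /sumprod_norm addrACA lerD// ler_normD. Qed.

Let sumprod_normZ (a : K) (p : sumprod E F) :
  sumprod_norm (a *: p) = `|a| * sumprod_norm p.
Proof. by rewrite /sumprod_norm !normrZ mulrDr. Qed.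

Let sumprod_norm0_eq0 (p : sumprod E F) : sumprod_norm p = 0 -> p = 0.
Proof.
move=> /eqP; rewrite paddr_eq0// !normr_eq0 => /andP[/eqP p1 /eqP p2].
by case: p p1 p2 => /= ? ? -> ->.
Qed.

HB.instance Definition _ := Lmodule_isNormed.Build K (sumprod E F)
  sumprod_ler_normD sumprod_normZ sumprod_norm0_eq0.

End Sumprod.

(* A linear subspace as a normed space, with the norm of the ambient space. *)
Record subsp (K : numFieldType) (V : normedModType K) (S : submodClosed V) :=
  Subsp { subsp_val :> V; subsp_valP : subsp_val \in S }.

Section Subsp.
Context {K : numFieldType} {V : normedModType K} {S : submodClosed V}.

HB.instance Definition _ := [isSub for @subsp_val K V S].
HB.instance Definition _ := [Choice of subsp S by <:].
HB.instance Definition _ := [SubChoice_isSubLmodule of subsp S by <:].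

Definition subsp_norm (u : subsp S) : K := `|val u|.

Let subsp_ler_normD (u v : subsp S) :
  subsp_norm (u + v) <= subsp_norm u + subsp_norm v.
Proof. by rewrite /subsp_norm raddfD/= ler_normD. Qed.

Let subsp_normZ (a : K) (u : subsp S) :
  subsp_norm (a *: u) = `|a| * subsp_norm u.
Proof. by rewrite /subsp_norm linearZ/= normrZ. Qed.

Let subsp_norm0_eq0 (u : subsp S) : subsp_norm u = 0 -> u = 0.
Proof.
by move=> /eqP; rewrite normr_eq0 => /eqP u0; apply: val_inj; rewrite raddf0.
Qed.

HB.instance Definition _ := Lmodule_isNormed.Build K (subsp S)
  subsp_ler_normD subsp_normZ subsp_norm0_eq0.

End Subsp.

Section Operators.
Context {K : numFieldType}.

(* Meaningful for continuous linear maps; the default 0 is taken only when the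
   supremum does not exist. *)
Definition opnorm (E F : normedModType K) (f : E -> F) : K :=
  supremum 0 [set `|f x| | x in [set x : E | `|x| <= 1]].

Definition inverse (E F : normedModType K) (f : E -> F) : F -> E :=
  'pinv_(fun=> 0) setT f.

Definition isomorphism (E F : normedModType K) (f : E -> F) : Prop :=
  [/\ linear f, continuous f, bijective f & continuous (inverse f)].

End Operators.

Section Framework.
Context {K : numFieldType} {Q X Y Z : normedModType K}.

Definition That (T : Y -> X) (s : sumprod Z Y) : sumprod Z X := (s.1, T s.2).

Definition Ahat (B : sumprod Q X -> Z) (T : Y -> X) (G : sumprod Q X -> Y)
  (p : sumprod Q X) : sumprod Z X := (B p, p.2 - T (G p)).

Context {Xh : submodClosed X}.

(* The inclusions of [Q * Xh] in [Q * X] and of [Z * Xh] in [Z * X]. *)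
Definition subsp_incl (W : normedModType K) (p : sumprod W (subsp Xh)) :
  sumprod W X := (p.1, val p.2).

Definition Khat (B : sumprod Q X -> Z) (Th : Y -> subsp Xh)
  (G : sumprod Q X -> Y) (p : sumprod Q X) : sumprod Z X :=
  (B p, p.2 - val (Th (G p))).

Definition Ahath (B : sumprod Q X -> Z) (Th : Y -> subsp Xh)
  (G : sumprod Q X -> Y) (p : sumprod Q (subsp Xh)) : sumprod Z (subsp Xh) :=
  (B (subsp_incl p), p.2 - Th (G (subsp_incl p))).

End Framework.

(* Main.v *)
(* With [D = (T - Th) G], one has [Khat = Ahat + (0, D)] and
   [|Ahat^-1 (0, D p)| <= q |p|].  Hence [(1 - q) |p| <= |Ahat^-1| |Khat p|],
   and [Khat p = s] is a fixed point equation for a [q]-contraction of the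
   Banach space [Q * X], so [Khat] is bijective.  As [Khat p] lies in [Z * Xh] iff [p]
   lies in [Q * Xh], [Ahath] is bijective too, with the same bound.  The error
   estimate is the lower bound on [Khat] at [p - ph], since
   [Khat (p - ph) = (0, (T - Th) (G p + F))] and [T^-1 U = G p + F]. *)
Require Import Defs.
From HB Require Import structures.
From mathcomp Require Import all_boot all_order all_algebra.
From mathcomp Require Import all_classical all_reals all_analysis.

Set Implicit Arguments.
Unset Strict Implicit.
Unset Printing Implicit Defensive.

Import Order.TTheory GRing.Theory Num.Theory.
Import numFieldNormedType.Exports.

Local Open Scope classical_set_scope.
Local Open Scope ring_scope.

(** * Bounded linear maps and their operator norm *)

Section BoundedLinear.
Context {K : numFieldType} {E F : normedModType K}.
Implicit Types (f : E -> F).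

(** Lets results on bundled linear maps apply to plain functions such as [inverse f]. *)
Let pack_linear f (lf : linear f) : {linear E -> F} :=
  HB.pack f (GRing.isLinear.Build _ _ _ _ f lf).

Lemma linear_fun0 f : linear f -> f 0 = 0.
Proof. by move=> lf; rewrite -[f]/(pack_linear lf : E -> F) linear0. Qed.

Lemma linear_funB f : linear f -> {morph f : x y / x - y}.
Proof. by move=> lf x y; rewrite -[f]/(pack_linear lf : E -> F) linearB. Qed.

Lemma linear_funZ f a : linear f -> {morph f : x / a *: x}.
Proof. by move=> lf x; rewrite -[f]/(pack_linear lf : E -> F) linearZ. Qed.

Lemma linear_continuous_bound f : linear f -> continuous f ->
  exists2 C, 0 <= C & forall x, `|f x| <= C * `|x|.
Proof.
move=> lf cf; have [_ /(_ cf)/linear_boundedP] :=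
  linear_bounded_continuous (pack_linear lf).
by move=> /pinfty_ex_gt0[C /ltW C0 Cf]; exists C.
Qed.

Lemma linear_bound_continuous f C : linear f -> 0 <= C ->
  (forall x, `|f x| <= C * `|x|) -> continuous f.
Proof.
move=> lf C0 Cf; apply: (@bounded_linear_continuous _ _ _ (pack_linear lf)).
apply/linear_boundedP; exists C; split; first exact: ger0_real.
by move=> r /ltW Cr x; rewrite (le_trans (Cf x))// ler_wpM2r.
Qed.

(** Either value of [supremum] obeys the bound: the default 0 is at most [C], and a genuine supremum
    is below the upper bound [C]. *)
Lemma opnorm_le f C : 0 <= C -> (forall x, `|f x| <= C * `|x|) ->
  opnorm f <= C.
Proof.
move=> C0 Cf; rewrite /opnorm /supremum; case: ifP => // _.
case: xgetP => // s _ [_]; apply => _ [x /= x1 <-].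
by rewrite (le_trans (Cf x))// ler_piMr.
Qed.

Hypothesis hK : real_complete K.

(** By [real_complete] the bounded set of values has a least upper bound, so [xget] returns a true
    supremum and not the default. *)
Lemma opnorm_ub f C : (forall x, `|f x| <= C * `|x|) -> 0 <= C ->
  forall x, `|x| <= 1 -> `|f x| <= opnorm f.
Proof.
move=> Cf C0 x x1; rewrite /opnorm /supremum;
  set A := (X in xget _ (supremums X)).
have Afx : A `|f x| by exists x.
have [A0|_] := eqVneq A set0; first by rewrite A0 in Afx.
have [l Al] : exists l, supremums A l.
  apply: hK; first by exists `|f x|.
    by move=> _ [y _ <-] /=; exact: normr_real.
  by exists C => _ [y /= y1 <-]; rewrite (le_trans (Cf y))// ler_piMr.
by have [+ _] := xgetPex 0 (ex_intro _ l Al); exact.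
Qed.

(** By homogeneity, a nonzero [x] is rescaled to norm 1 and [opnorm_ub] applies. *)
Lemma opnorm_bound f : linear f -> continuous f ->
  0 <= opnorm f /\ forall x, `|f x| <= opnorm f * `|x|.
Proof.
move=> lf /(linear_continuous_bound lf)[C C0 Cf].
have ub := opnorm_ub Cf C0; split.
  by apply: le_trans (ub 0 _); rewrite ?normr0.
move=> x; have [->|x0] := eqVneq x 0.
  by rewrite linear_fun0// !normr0 mulr0.
have nx : 0 < `|x| by rewrite normr_gt0.
have /ub : `| `|x|^-1 *: x| <= 1.
  by rewrite normrZ normfV normr_id mulVf ?gt_eqF.
by rewrite linear_funZ// normrZ normfV normr_id mulrC ler_pdivrMr.
Qed.

End BoundedLinear.

(** * Inverses, and isomorphisms obtained from lower bounds *)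

Section Inverse.
Context {K : numFieldType} {E F : normedModType K}.
Implicit Types (f : E -> F).

Lemma inverseK f : bijective f -> cancel f (inverse f).
Proof.
move=> /bij_inj injf x; apply: (@pinvKV _ _ _ setT); last exact: in_setT.
by move=> a b _ _ /injf.
Qed.

Lemma inverseKr f : bijective f -> cancel (inverse f) f.
Proof.
by move=> [g fK gK] y; apply: pinvK; rewrite inE; exists (g y).
Qed.

Lemma linear_inverse f : linear f -> bijective f -> linear (inverse f).
Proof.
move=> lf bf a x y; apply: (bij_inj bf).
by rewrite lf !(inverseKr bf).
Qed.

Lemma bounded_below_inj f c : linear f -> (forall x, `|x| <= c * `|f x|) ->
  injective f.
Proof.
move=> lf cf x y fxy; apply/eqP; rewrite -subr_eq0 -normr_le0.
by rewrite (le_trans (cf _))// linear_funB// fxy subrr normr0 mulr0.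
Qed.

(** The lower bound yields injectivity and, read at [inverse f y], the bound [c] on the inverse.
    Every isomorphism constructed below comes from this criterion. *)
Lemma isomorphism_bounded_below f C c : linear f -> 0 <= C -> 0 <= c ->
  (forall x, `|f x| <= C * `|x|) -> (forall x, `|x| <= c * `|f x|) ->
  (forall y, exists x, f x = y) ->
  isomorphism f /\ opnorm (inverse f) <= c.
Proof.
move=> lf C0 c0 Cf cf /choice[g gK].
have injf := bounded_below_inj lf cf.
have bf : bijective f by exists g => // x; exact/injf/gK.
have ic y : `|inverse f y| <= c * `|y|.
  by rewrite -{2}(inverseKr bf y).
split; last exact: opnorm_le.
split => //; first exact: linear_bound_continuous Cf.
exact: linear_bound_continuous (linear_inverse lf bf) _ ic.
Qed.

Lemma isomorphism_inverse_bound f : isomorphism f ->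
  exists2 c, 0 <= c & forall x, `|x| <= c * `|f x|.
Proof.
move=> [lf _ bf cf].
have [c c0 ic] := linear_continuous_bound (linear_inverse lf bf) cf.
by exists c => // x; rewrite -{1}(inverseK bf x).
Qed.

End Inverse.

(** * The contraction principle over [K] *)

Section Contraction.
Context {K : numFieldType}.
Hypothesis hK : real_complete K.

(** Otherwise the inverse powers of [q] are bounded by [e^-1] and have a least upper bound [l > 0].
    Since [q ^- n = q * q ^- n.+1], also [q * l] is an upper bound, so [l <= q * l < l]. *)
Lemma real_complete_expr_lt (q e : K) : 0 <= q -> q < 1 -> 0 < e ->
  exists n, q ^+ n < e.
Proof.
move=> q0 q1 e0; apply: contrapT => /forallNP qe.
have {}qe n : e <= q ^+ n.
  rewrite real_leNgt; first exact/negP/qe.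
    exact: gtr0_real.
  by rewrite ger0_real// exprn_ge0.
have qgt0 : 0 < q by rewrite (lt_le_trans e0)// -[q]expr1.
have [l [ubl lel]] : exists l, supremums [set q ^- n | n in setT] l.
  apply: hK.
  - by exists (q ^- 0), 0%N.
  - by move=> _ [n _ <-] /=; rewrite ger0_real// invr_ge0 exprn_ge0.
  - by exists e^-1 => _ [n _ <-]; rewrite lef_pV2 ?posrE ?exprn_gt0.
have l0 : 0 < l.
  have l1 : 1 <= l by apply: ubl; exists 0%N; rewrite // expr0 invr1.
  exact: lt_le_trans l1.
have : l <= q * l.
  apply: lel => _ [n _ <-]; rewrite -ler_pdivrMl// -invfM -exprS.
  by apply: ubl; exists n.+1.
by rewrite lt_geF// gtr_pMl.
Qed.

Lemma contraction_fixed_point (E : completeNormedModType K) (f : E -> E)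
    (q : K) : 0 <= q -> q < 1 ->
  (forall x y, `|f x - f y| <= q * `|x - y|) -> exists x, f x = x.
Proof.
(* [M] solves [M = q * M + |f 0|], which makes the bound [|u n| <= M] stable under induction. *)
move=> q0 q1 cf; pose u n := iter n f 0; pose M := `|f 0| / (1 - q).
have q1' : 0 < 1 - q by rewrite subr_gt0.
have M0 : 0 <= M by rewrite divr_ge0// ltW.
have uM n : `|u n| <= M.
  elim: n => [|n IHn]; first by rewrite normr0.
  rewrite -[u n.+1](subrK (f 0)) (le_trans (ler_normD _ _))//.
  rewrite (_ : M = q * M + `|f 0|).
    by rewrite lerD2r (le_trans (cf _ _))// subr0 ler_wpM2l.
  apply/eqP; rewrite addrC -subr_eq -{1}[M]mul1r -mulrBl mulrC.
    by rewrite /M divfK// gt_eqF.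
have uq n m : `|u n - u (n + m)%N| <= q ^+ n * M.
  elim: n => [|n IHn]; first by rewrite sub0r normrN mul1r uM.
  by rewrite addSn (le_trans (cf _ _))// exprS -mulrA ler_wpM2l.
have /cauchy_cvg/cvg_ex[l ul] : cauchy (u n @[n --> \oo]).
  apply: cauchy_exP => e e0.
  (* The power is taken below [e / (M + 1)], as [M] itself may be 0. *)
  have [n qn] := real_complete_expr_lt q0 q1 (divr_gt0 e0 (ltr_wpDl M0 ltr01)).
  exists (u n); exists n => // m /= nm; rewrite -ball_normE /ball_/=.
  rewrite -(subnKC nm) (le_lt_trans (uq _ _))//.
  rewrite ltr_pdivlMr in qn; last exact: ltr_wpDl.
  by rewrite (le_lt_trans _ qn)// ler_wpM2l ?exprn_ge0 ?lerDl.
(* The shifted sequence [f (u n)] tends both to [l] and to [f l]. *)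
exists l; suff ufl : u n @[n --> \oo] --> f l.
  exact: (@cvg_unique _ (@norm_hausdorff _ E) (u n @[n --> \oo])).
rewrite -(cvg_shiftS u); apply/cvgrPdist_lt => e e0; near=> n.
rewrite (le_lt_trans (cf _ _))// (le_lt_trans (ler_piMl _ (ltW q1)))//.
by near: n; exact: cvgr_dist_lt.
Unshelve. all: by end_near. Qed.

End Contraction.

(** * Completeness of products, composition and products of isomorphisms *)

Lemma normr_sumprod (K : numFieldType) (E F : normedModType K)
  (p : sumprod E F) : `|p| = `|p.1| + `|p.2|.
Proof. by []. Qed.

Section SumprodComplete.
Context {K : numFieldType} {E F : completeNormedModType K}.

(** The projections do not increase the sum norm, so both image filters are Cauchy; their limits,
    each approached within [e / 2], form the limit. The fixed point argument for [Khat] runs in this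
    space. *)
Let sumprod_complete (A : set_system (sumprod E F)) :
  ProperFilter A -> cauchy A -> cvg A.
Proof.
move=> AP /cauchyP cA.
have /cauchy_cvg/cvg_ex[l1 cl1] : cauchy (p.1 @[p --> A]).
  apply: cauchy_exP => e /cA[p Ap]; exists p.1.
  apply: (@filterS _ A _ _ (fun r => ball p.1 e r.1)) Ap => r.
  rewrite -!ball_normE /ball_/=; apply: le_lt_trans.
  by rewrite -[leRHS]/(`|p.1 - r.1| + `|p.2 - r.2|) lerDl.
have /cauchy_cvg/cvg_ex[l2 cl2] : cauchy (p.2 @[p --> A]).
  apply: cauchy_exP => e /cA[p Ap]; exists p.2.
  apply: (@filterS _ A _ _ (fun r => ball p.2 e r.2)) Ap => r.
  rewrite -!ball_normE /ball_/=; apply: le_lt_trans.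
  by rewrite -[leRHS]/(`|p.1 - r.1| + `|p.2 - r.2|) lerDr.
apply/cvg_ex; exists ((l1, l2) : sumprod E F).
apply/(@cvgrPdist_lt _ _ _ A _ id) => e e0.
have e20 : 0 < e / 2 by rewrite divr_gt0.
have n1 := @cvgr_dist_lt _ _ _ A _ _ _ cl1 _ e20.
have n2 := @cvgr_dist_lt _ _ _ A _ _ _ cl2 _ e20.
apply: (filterS2 _ _ (n1 _) (n2 _)) => p p1 p2.
rewrite -[ltLHS]/(`|l1 - p.1| + `|l2 - p.2|) [ltRHS]splitr.
exact: ltrD.
Qed.

HB.instance Definition _ :=
  Uniform_isComplete.Build (sumprod E F) sumprod_complete.

End SumprodComplete.

Lemma isomorphism_bounds (K : numFieldType) (E F : normedModType K)
    (f : E -> F) : isomorphism f ->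
  exists C c, [/\ 0 <= C, 0 <= c, forall x, `|f x| <= C * `|x|
    & forall x, `|x| <= c * `|f x|].
Proof.
move=> hf; have [lf cf _ _] := hf.
have [C C0 fC] := linear_continuous_bound lf cf.
by have [c c0 fc] := isomorphism_inverse_bound hf; exists C, c.
Qed.

Lemma isomorphism_comp (K : numFieldType) (E F W : normedModType K)
    (f : F -> W) (g : E -> F) :
  isomorphism f -> isomorphism g -> isomorphism (f \o g).
Proof.
move=> hf hg; have [C [c [C0 c0 fC fc]]] := isomorphism_bounds hf.
have [C' [c' [C'0 c'0 gC gc]]] := isomorphism_bounds hg.
have [lf _ [f' _ f'K] _] := hf; have [lg _ [g' _ g'K] _] := hg.
apply: (@isomorphism_bounded_below _ _ _ _ (C * C') (c' * c) _ _ _ _ _ _).1.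
- by move=> a x y /=; rewrite lg lf.
- exact: mulr_ge0.
- exact: mulr_ge0.
- by move=> x; rewrite (le_trans (fC _))// -mulrA ler_wpM2l.
- by move=> x; rewrite (le_trans (gc _))// -mulrA ler_wpM2l.
- by move=> y; exists (g' (f' y)); rewrite /= g'K.
Qed.

Lemma isomorphism_That (K : numFieldType) (X Y Z : normedModType K)
  (T : Y -> X) : isomorphism T -> isomorphism (That (Z := Z) T).
Proof.
move=> hT; have [C [c [C0 c0 TC Tc]]] := isomorphism_bounds hT.
have [lT _ [T' _ T'K] _] := hT.
(* [1 + C] dominates both 1, for the identity on [Z], and [C], for [T]; likewise [1 + c] for the
   lower bound. *)
have [C1 c1] : 0 <= 1 + C /\ 0 <= 1 + c by rewrite !addr_ge0.
apply: (isomorphism_bounded_below _ C1 c1 _ _ _).1.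
- by move=> a x y; rewrite /That /= lT.
- move=> x; rewrite !normr_sumprod /= mulrDr lerD//.
    by rewrite ler_peMl// lerDl.
  by rewrite (le_trans (TC _))// ler_wpM2r// lerDr.
- move=> x; rewrite !normr_sumprod /= mulrDr lerD//.
    by rewrite ler_peMl// lerDl.
  by rewrite (le_trans (Tc _))// ler_wpM2r// lerDr.
- by move=> y; exists (y.1, T' y.2); rewrite /That /= T'K -surjective_pairing.
Qed.

(** * The perturbed operator [Khat] and its restriction [Ahath] *)

Section Approximation.
Context {K : numFieldType} {Q X Y Z : completeNormedModType K}.
Hypothesis hK : real_complete K.
Variable T : Y -> X.
Hypothesis hT : isomorphism T.
Variables (G : {linear sumprod Q X -> Y}) (B : {linear sumprod Q X -> Z}).
Hypothesis hG : continuous G.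
Hypothesis hA : isomorphism (Ahat B T G).
Variables (Xh : submodClosed X) (Th : {linear Y -> subsp Xh}).
Hypothesis hTh : continuous Th.

Let D (p : sumprod Q X) : X := T (G p) - val (Th (G p)).
Let N := opnorm (inverse (Ahat B T G)).
Let q := opnorm D * N.
Hypothesis hq1 : q < 1.

Let linear_T : linear T. Proof. by case: hT. Qed.

Let linear_D : linear D.
Proof.
by move=> a x y; rewrite /D !linearP linear_T /= addrACA -scalerDr.
Qed.

(** Gives the continuity of [D], so that [opnorm D] is its true norm, and later the continuity bound
    for [Ahath]. *)
Let D_bound : exists2 C, 0 <= C & forall p, `|D p| <= C * `|p|.
Proof.
have [CT [_ [CT0 _ TC _]]] := isomorphism_bounds hT.
have [CG CG0 GC] := linear_continuous_bound (linearP G) hG.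
have [Ch Ch0 hC] := linear_continuous_bound (linearP Th) hTh.
exists ((CT + Ch) * CG); first by rewrite mulr_ge0// addr_ge0.
move=> p; rewrite -mulrA (le_trans (ler_normB _ _))// mulrDl lerD//.
  by rewrite (le_trans (TC _))// ler_wpM2l.
by rewrite (le_trans (hC _))// ler_wpM2l.
Qed.

Let continuous_D : continuous D.
Proof. by have [C C0 DC] := D_bound; exact: linear_bound_continuous DC. Qed.

Let N_ge0 : 0 <= N.
Proof.
have [lA _ bA cA] := hA.
by have [] := opnorm_bound hK (linear_inverse lA bA) cA.
Qed.

Let Ainv_bound s : `|inverse (Ahat B T G) s| <= N * `|s|.
Proof.
have [lA _ bA cA] := hA.
by have [_] := opnorm_bound hK (linear_inverse lA bA) cA.
Qed.

Let D_opnorm : 0 <= opnorm D /\ forall p, `|D p| <= opnorm D * `|p|.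
Proof. exact: opnorm_bound. Qed.

Let q_ge0 : 0 <= q.
Proof. by have [D0 _] := D_opnorm; rewrite mulr_ge0. Qed.

Let norm_0D p : `|((0, D p) : sumprod Z X)| = `|D p|.
Proof. by rewrite normr_sumprod normr0 add0r. Qed.

Let KhatE p : Khat B Th G p = Ahat B T G p + ((0, D p) : sumprod Z X).
Proof.
by congr pair; rewrite /= ?addr0// /D addrA subrK.
Qed.

(** From [|p| <= N * |Ahat p| <= N * (|Khat p| + |D p|)], the term [N * |D p| <= q * |p|] is
    absorbed on the left. *)
Lemma Khat_bounded_below p :
  `|p| <= (1 - q)^-1 * N * `|Khat B Th G p|.
Proof.
have [lA _ bA cA] := hA; have [_ Dp] := D_opnorm.
rewrite -mulrA ler_pdivlMl ?subr_gt0// mulrBl mul1r lerBlDr.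
rewrite -{1}(inverseK bA p) (le_trans (Ainv_bound _))//.
rewrite /q (mulrC _ N) -mulrA -mulrDr ler_wpM2l//.
have -> : Ahat B T G p = Khat B Th G p - ((0, D p) : sumprod Z X).
  by rewrite KhatE addrK.
by rewrite (le_trans (ler_normB _ _))// lerD2l norm_0D.
Qed.

(* A solution of [Khat p = s] is a fixed point of the contraction
   [p |-> Ahat^-1 (s - (0, D p))]. *)
Lemma Khat_surj s : exists p, Khat B Th G p = s.
Proof.
have [lA _ bA cA] := hA; have [_ Dp] := D_opnorm.
pose f p := inverse (Ahat B T G) (s - ((0, D p) : sumprod Z X)).
have [|p fp] := @contraction_fixed_point _ hK _ f q q_ge0 hq1.
  move=> x y; rewrite /f -linear_funB; last exact: linear_inverse.
  rewrite (le_trans (Ainv_bound _))// /q (mulrC _ N) -mulrA ler_wpM2l//.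
  (* The datum [s] cancels and linearity of [D] leaves [D (y - x)], whence the factor [q]. *)
  have -> : s - ((0, D x) : sumprod Z X) - (s - ((0, D y) : sumprod Z X)) =
      ((0, D (y - x)) : sumprod Z X).
    rewrite opprB addrC addrA subrK (linear_funB linear_D).
    by congr pair; exact: subrr.
  by rewrite norm_0D (distrC x); exact: Dp.
by exists p; rewrite KhatE -{1}fp /f inverseKr// subrK.
Qed.

Let Ah := Ahath B Th G.

(** Along the isometric inclusion [subsp_incl], [Ahath] is the restriction of [Khat], so bounds for
    [Khat] pass to [Ahath]. *)
Let incl_Ah g : subsp_incl (Ah g) = Khat B Th G (subsp_incl g).
Proof. by []. Qed.

Let norm_incl (W : normedModType K) (g : sumprod W (subsp Xh)) :
  `|subsp_incl g| = `|g|.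
Proof. by []. Qed.

Let incl_inj (W : normedModType K) :
  injective (@subsp_incl K X Xh W).
Proof. by move=> [w u] [w' u'] [-> /val_inj->]. Qed.

Lemma Ahath_linear : linear Ah.
Proof.
have lincl W : linear (@subsp_incl K X Xh W) by [].
move=> a x y; rewrite {1}/Ah /Ahath lincl !linearP.
by congr pair; rewrite /= addrACA -scalerDr.
Qed.

Lemma Ahath_bound : exists2 C, 0 <= C & forall g, `|Ah g| <= C * `|g|.
Proof.
have [CA [_ [CA0 _ AC _]]] := isomorphism_bounds hA.
have [CD CD0 DC] := D_bound.
exists (CA + CD) => [|g]; first exact: addr_ge0.
rewrite -norm_incl incl_Ah KhatE (le_trans (ler_normD _ _))// mulrDl.
by rewrite norm_0D lerD// -norm_incl.
Qed.

Lemma Ahath_bounded_below g : `|g| <= (1 - q)^-1 * N * `|Ah g|.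
Proof. exact: (Khat_bounded_below (subsp_incl g)). Qed.

Lemma Ahath_surj s : exists g, Ah g = s.
Proof.
have [[x U] KxU] := Khat_surj (subsp_incl s).
(* [U] is the second component of [s] plus [Th (G (x, U))], both in [Xh]. *)
have UXh : U \in Xh.
  move: KxU => [_ /= /eqP]; rewrite subr_eq => /eqP ->.
  by apply: rpredD; exact: subsp_valP.
exists (x, Subsp UXh); apply: incl_inj; exact: KxU.
Qed.

End Approximation.

(* [Gamma_*] is the whole of [Gamma_h]: since [Th] takes its values in [Xh],
   [U - Th G(x, U)] lies in [Xh] exactly when [U] does. *)
Definition full_pred (V : Type) : {pred V} := predT.

HB.instance Definition _ (K : numFieldType) (V : normedModType K) :=
  GRing.isSubmodClosed.Build K V (@full_pred V)
    (conj (conj isT (fun _ _ _ _ => isT)) (fun _ _ _ => isT)).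

(** * The isomorphism onto the discrete space, unique solvability and the error estimate *)

Theorem theorem4p2 (K : numFieldType) (hK : real_complete K)
  (Q X Y Z : completeNormedModType K)
  (T : Y -> X) (hT : isomorphism T)
  (G : {linear sumprod Q X -> Y}) (hG : continuous G)
  (B : {linear sumprod Q X -> Z}) (hB : continuous B)
  (Phi : sumprod Q X -> sumprod Z Y) (hPhi : isomorphism Phi)
  (hA : Ahat B T G = That T \o Phi)
  (Xh : submodClosed X) (hXh : closed [set` Xh])
  (Th : {linear Y -> subsp Xh}) (hTh : continuous Th)
  (hThY : range Th = setT)
  (normAinv : K) (hnormAinv : normAinv = opnorm (inverse (Ahat B T G)))
  (q : K)
  (hq : q = opnorm (fun p : sumprod Q X => T (G p) - val (Th (G p)))
            * normAinv)
  (hq1 : q < 1) :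
  (exists Gs : submodClosed (sumprod Q (subsp Xh)),
    let As := fun g : subsp Gs => Ahath B Th G (val g) in
    let Gs_in_Gamma := [set subsp_incl g | g in [set` Gs]] in
    [/\ [set` Gs] !=set0,
        closed [set` Gs],
        isomorphism As,
        [/\ Gs_in_Gamma = Khat B Th G @^-1` (setT `*` range (val \o Th)),
            Gs_in_Gamma = Khat B Th G @^-1` (setT `*` [set` Xh])
          & Gs_in_Gamma = Khat B Th G @^-1` range (@subsp_incl K X Xh Z)]
      & opnorm (inverse As) <= (1 - q)^-1 * normAinv])
  /\
  (forall (FB : Z) (F : Y),
    exists (ph : sumprod Q (subsp Xh)) (p : sumprod Q X),
    [/\ unique (fun ph' : sumprod Q (subsp Xh) =>
          B (subsp_incl ph') = FB /\ ph'.2 - Th (G (subsp_incl ph')) = Th F) ph,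
        unique (fun p' : sumprod Q X =>
          B p' = FB /\ p'.2 - T (G p') = T F) p
      & `|p - subsp_incl ph| <= (1 - q)^-1 * normAinv
          * `|T (inverse T p.2) - val (Th (inverse T p.2))|]).
Proof.
have iA : isomorphism (Ahat B T G).
  by rewrite hA; exact/isomorphism_comp/hPhi/isomorphism_That.
rewrite hnormAinv in hq *.
have q1 : opnorm (fun p => T (G p) - val (Th (G p))) *
  opnorm (inverse (Ahat B T G)) < 1 by rewrite -hq.
have c0 : 0 <= (1 - q)^-1 * opnorm (inverse (Ahat B T G)).
  have [lA _ bA cA] := iA.
  by rewrite mulr_ge0 ?invr_ge0 ?subr_ge0 ?(ltW hq1)//;
    have [] := opnorm_bound hK (linear_inverse lA bA) cA.
have bounded_below (g : sumprod Q (subsp Xh)) :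
    `|g| <= (1 - q)^-1 * opnorm (inverse (Ahat B T G)) * `|Ahath B Th G g|.
  by rewrite hq; exact: Ahath_bounded_below.
have surj := Ahath_surj hK hT hG iA hTh q1.
have Ah_inj := bounded_below_inj (Ahath_linear G B Th) bounded_below.
have [lT _ bT _] := hT.
split.
  exists [the submodClosed _ of @full_pred (sumprod Q (subsp Xh))].
  move=> As Gs_in_Gamma.
  have GsE : Gs_in_Gamma = [set p | p.2 \in Xh].
    apply/seteqP; split => [_ [g _ <-]|[x U] /= UXh]; first exact: subsp_valP.
    by exists (x, Subsp UXh).
  (* The second components of [Khat p] and [p] differ by an element of [Xh]; this turns each of the
     three preimages into the condition [p.2 \in Xh]. *)
  have KhatXh p : ((Khat B Th G p).2 \in Xh) = (p.2 \in Xh).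
    rewrite /Khat /=; set w := Th _; apply/idP/idP => pXh.
      by rewrite -(subrK (val w) p.2) rpredD// subsp_valP.
    by rewrite rpredD// -scaleN1r rpredZ// subsp_valP.
  have [C C0 AhC] := Ahath_bound hT hG iA hTh.
  have [iAs As_le] : isomorphism As /\
      opnorm (inverse As) <= (1 - q)^-1 * opnorm (inverse (Ahat B T G)).
    apply: (isomorphism_bounded_below _ C0 c0).
    - move=> a x y.
      have lv : val (a *: x + y) = a *: val x + val y by rewrite linearP.
      by rewrite /As lv; exact: Ahath_linear.
    - by move=> g; exact: AhC.
    - by move=> g; exact: (bounded_below (val g)).
    - by move=> s; have [g gs] := surj s;
        exists (Subsp (isT : g \in @full_pred _)).
  split => //.
  - by exists 0.
  - split; rewrite GsE; apply/seteqP; split => p /=.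
    + rewrite -KhatXh => pXh; split=> //.
      (* Surjectivity of [Th] onto [Xh] provides a preimage in [Y] of the second component. *)
      have : range Th (Subsp pXh) by rewrite hThY.
      by move=> [y _ Thy]; exists y => //=; rewrite Thy.
    + by move=> [_ [y _ ypE]]; rewrite -KhatXh /Khat /= -ypE subsp_valP.
    + by rewrite -KhatXh.
    + by move=> [_]; rewrite -KhatXh.
    + by rewrite -KhatXh => pXh; exists ((Khat B Th G p).1, Subsp pXh).
    + by move=> [g _ gp]; rewrite -KhatXh -gp subsp_valP.
move=> FB F.
have [ph phE] := surj (FB, Th F).
have [lA _ [A' A'K AK'] _] := iA.
pose p := A' (FB, T F).
have pE : Ahat B T G p = (FB, T F) by exact: AK'.
exists ph, p; split.
- split; first by move: phE => [].
  move=> g [gB gT]; apply: Ah_inj.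
  by rewrite phE /Ahath gB gT.
- split; first by move: pE => [].
  by move=> r [rB rT]; apply: (can_inj A'K); rewrite pE /Ahat rB rT.
have [pB /eqP] := pE; rewrite subr_eq addrC => /eqP p2.
have [phB /eqP] := phE; rewrite subr_eq => /eqP ph2.
(* In this form [inverse T p.2] is [G p + F], the argument of [T - Th] in the estimate. *)
have {}p2 : p.2 = T (G p + F).
  by have := lT 1 (G p) F; rewrite !scale1r => ->.
rewrite p2 inverseK//.
(* The first components cancel, both being [FB]; in the second, the terms [Th (G (subsp_incl ph))]
   cancel. *)
have dE : Khat B Th G (p - subsp_incl ph) =
    (0, T (G p + F) - val (Th (G p + F))).
  congr pair; first by rewrite linearB /= pB phB subrr.
  rewrite /= p2 ph2 !linearB !linearD /=.
  by rewrite -addrA opprK addrACA addNr addr0 (addrC (- val (Th F))).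
have -> : `|T (G p + F) - val (Th (G p + F))| =
    `|Khat B Th G (p - subsp_incl ph)|.
  by rewrite dE normr_sumprod /= normr0 add0r.
by rewrite hq; exact: Khat_bounded_below.
Qed.
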